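(* Consider the problem of minimizing $f(x)=g(x_1,\dots,x_K)+\sum_{k=1}^Kh_k(x_k)$ over $x\in X=\prod_{k=1}^KX_k$. Suppose Assumption A (stated in the context) holds and that $h(x)=\sum_kh_k(x_k)$ satisfies $|h(x)-h(y)|\le L_h\|x-y\|$ for all $x,y\in X$, with some $L_h>0$. Let $u_k$, $k=1,\dots,K$, be any functions satisfying Assumption B (stated in the context). Let $\{x^r\}$ be the sequence generated by the block coordinate minimization (BCM) algorithm with the maximum block improvement (MBI) rule. Then (without requiring $g$ to be block-wise strongly convex), for all $r\ge1$, $$\Delta^r=f(x^r)-f^*\le\frac1{\sigma_3r},\qquad \sigma_3=\frac{\gamma}{2K\left((Q+L_h)^2+L_{\max}^2KR^2\right)}.$$
   Context: Setting: $x=(x_1,\dots,x_K)\in\mathbb{R}^n$ with blocks $x_k\in X_k\subseteq\mathbb{R}^{n_k}$, $X=\prod_kX_k$ convex; $g$ is smooth and convex; each $h_k$ is convex, possibly nonsmooth; $f$ is closed, proper, convex. $\|\cdot\|$ is the Euclidean norm; $x_{-k}$ is $x$ with block $k$ removed. $X^*$ is the optimal solution set, $f^*$ the optimal value. Assumption A. (a) The problem is convex, its global minimum is attained, and $X\cap\mathrm{int}(\mathrm{dom}\,f)\ne\emptyset$. (b) $\|\nabla_kg([x_{-k},x_k])-\nabla_kg([x_{-k},x_k'])\|\le M_k\|x_k-x_k'\|$ for all $x_k,x_k'\in X_k$, $x\in X$, all $k$, with $M_k>0$; and $\|\nabla g(x)-\nabla g(x')\|\le M\|x-x'\|$ for all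 $x,x'\in X$, with $M>0$. Assumption B. For each $k$, the function $u_k(v_k;x)$, $v_k\in X_k$, $x\in X$, with $\nabla u_k$ denoting the gradient in the first argument, satisfies: (a) $u_k(x_k;x)=g(x)$ for all $x\in X$; (b) $u_k(v_k;x)\ge g(v_k,x_{-k})$ for all $v_k\in X_k$, $x\in X$; (c) $\nabla u_k(x_k;x)=\nabla_kg(x)$ for all $x\in X$; (d) $u_k$ is continuous in $(v_k,x)$ and $u_k(v_k;x)\ge u_k(\hat v_k;x)+\langle\nabla u_k(\hat v_k;x),v_k-\hat v_k\rangle+\frac{\gamma_k}2\|v_k-\hat v_k\|^2$ for all $v_k,\hat v_k\in X_k$, $x\in X$, with $\gamma_k>0$ independent of $x$; (e) $\|\nabla u_k(v_k;x)-\nabla u_k(\hat v_k;x)\|\le L_k\|v_k-\hat v_k\|$ for all $v_k,\hat v_k\in X_k$, $x\in X$ (with $L_k>0$), and $\|\nabla u_k(v_k;x)-\nabla u_k(v_k;y)\|\le G_k\|x-y\|$ for all $v_k\in X_k$, $x,y\in X$. Constants: $\gamma=\frac12\min_k\gamma_k$, $L_{\max}=\max_kL_k$, $R=\max_{x\in X}\max_{x^*\in X^*}\{\|x-x^*\|:f(x)\le f(x^1)\}$, $Q=\max_{x\in X}\{\|\nabla g(x)\|:f(x)\le f(x^1)\}$; the level set $\{x:f(x)\le f(x^1)\}$ is assumed compact so that these are finite. BCM with the MBI rule: at iteration $r+1$ choose $k^*$ minimizing over $k$ the value $\min_{x_k\in X_k}f(x_k,x_{-k}^r)$; set $x_{k^*}^{r+1}\in\arg\min_{x_{k^*}\in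 X_{k^*}}g(x_{k^*},x_{-k^*}^r)+h_{k^*}(x_{k^*})$ and $x_k^{r+1}=x_k^r$ for $k\neq k^*$. *)

(* Defs.v *)
From HB Require Import structures.
From mathcomp Require Import all_boot all_order all_algebra.
From mathcomp Require Import all_classical all_reals all_analysis.

Set Implicit Arguments.
Unset Strict Implicit.
Unset Printing Implicit Defensive.

Import Order.TTheory GRing.Theory Num.Theory.
Import numFieldNormedType.Exports.

Local Open Scope classical_set_scope.
Local Open Scope ring_scope.

(* The norm of the library on 'rV[R]_d is the sup norm, hence the explicit
   Euclidean inner product and norm; the topology is the same. *)
Definition edot (R : realType) (d : nat) (u v : 'rV[R]_d) : R :=
  \sum_i u 0 i * v 0 i.

Definition enorm (R : realType) (d : nat) (v : 'rV[R]_d) : R :=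
  Num.sqrt (edot v v).

(* Meaningful where [f] is differentiable, which is always assumed
   separately. *)
Definition grad (R : realType) (d : nat) (f : 'rV[R]_d -> R) (x : 'rV[R]_d) :
    'rV[R]_d :=
  \row_i 'D_(delta_mx 0 i) f x.

(* Convexity, closedness and properness of extended-real-valued functions are
   those of convex analysis, through the epigraph. *)
Definition epi (R : realType) (d : nat) (f : 'rV[R]_d -> \bar R) :
    set ('rV[R]_d * R)%type :=
  [set p | (f p.1 <= p.2%:E)%E].

Definition ext_convex (R : realType) (d : nat) (f : 'rV[R]_d -> \bar R) :=
  convex_set (epi f).

Definition ext_closed (R : realType) (d : nat) (f : 'rV[R]_d -> \bar R) :=
  closed (epi f).

Definition dom (R : realType) (d : nat) (f : 'rV[R]_d -> \bar R) :
    set 'rV[R]_d :=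
  [set x | (f x < +oo)%E].

Definition ext_proper (R : realType) (d : nat) (f : 'rV[R]_d -> \bar R) :=
  (forall x, (-oo < f x)%E) /\ dom f !=set0.

Definition argmin_on (R : realType) (T : Type) (D : set T) (f : T -> \bar R) :
    set T :=
  [set x | D x /\ forall y, D y -> (f x <= f y)%E].

Section Blocks.
Context {R : realType} {K : nat} {n : 'I_K -> nat}.

(* A point x of R^n, n = \sum_k n_k, is a row of length \sum_k n k, whose k-th
   block x_k is [submxrow x k : 'rV_(n k)]. *)
Local Notation vec := 'rV[R]_(\sum_(k < K) n k)%N.
Local Notation block k := 'rV[R]_(n k).

(* The point [x_{-k}, v], i.e. x with its k-th block replaced by v. *)
Definition set_block (x : vec) (k : 'I_K) (v : block k) : vec :=
  \mxrow_j dfwith (fun i => submxrow x i) k v j.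
Arguments set_block x k v : clear implicits.

Definition prod_set (X : forall k, set (block k)) : set vec :=
  [set x | forall k, X k (submxrow x k)].

Definition grad_block (g : vec -> R) (k : 'I_K) (x : vec) : block k :=
  submxrow (grad g x) k.

(* The nonsmooth terms may take the value +oo, so that the effective domain
   of the objective may be a proper subset of the whole space. *)
Definition sep_sum (h : forall k, block k -> \bar R) (x : vec) : \bar R :=
  (\sum_k h k (submxrow x k))%E.

Definition objective (g : vec -> R) (h : forall k, block k -> \bar R)
    (x : vec) : \bar R :=
  ((g x)%:E + sep_sum h x)%E.

Definition optimal_set (X : forall k, set (block k)) (f : vec -> \bar R) :
    set vec :=
  argmin_on (prod_set X) f.

Definition optimal_value (X : forall k, set (block k)) (f : vec -> \bar R) :
    \bar R :=
  ereal_inf (f @` prod_set X).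

(* [g] is a total function, but only its values near the feasible set matter
   for its convexity and smoothness; continuity of its gradient on the
   feasible set is part of [A_lip]. *)
Record assumptionA (X : forall k, set (block k)) (g : vec -> R)
    (h : forall k, block k -> \bar R) (Mk : 'I_K -> R) (M : R) : Prop := {
  A_set_convex : convex_set (prod_set X) ;
  A_smooth : forall x, prod_set X x -> differentiable g x ;
  A_g_convex : convex_function (prod_set X) g ;
  A_h_convex : forall k, ext_convex (h k) ;
  A_f_closed : ext_closed (objective g h) ;
  A_f_proper : ext_proper (objective g h) ;
  A_f_convex : ext_convex (objective g h) ;
  A_attained : optimal_set X (objective g h) !=set0 ;
  A_interior : prod_set X `&` interior (dom (objective g h)) !=set0 ;
  A_Mk_gt0 : forall k, 0 < Mk k ;
  A_block_lip : forall k (x : vec) (v w : block k),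
    prod_set X x -> X k v -> X k w ->
    enorm (grad_block g k (set_block x k v) - grad_block g k (set_block x k w))
      <= Mk k * enorm (v - w) ;
  A_M_gt0 : 0 < M ;
  A_lip : forall x y, prod_set X x -> prod_set X y ->
    enorm (grad g x - grad g y) <= M * enorm (x - y)
}.

(* [u k v x] is u_k(v; x), and [grad (u k ^~ x) v] its gradient in v. *)
Record assumptionB (X : forall k, set (block k)) (g : vec -> R)
    (u : forall k, block k -> vec -> R) (gam L G : 'I_K -> R) : Prop := {
  B_diff : forall k (v : block k) (x : vec), X k v -> prod_set X x ->
    differentiable (u k ^~ x) v ;
  B_tight : forall k x, prod_set X x -> u k (submxrow x k) x = g x ;
  B_upper : forall k (v : block k) (x : vec), X k v -> prod_set X x ->
    g (set_block x k v) <= u k v x ;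
  B_grad : forall k x, prod_set X x ->
    grad (u k ^~ x) (submxrow x k) = grad_block g k x ;
  B_cont : forall k, {within X k `*` prod_set X,
    continuous (fun p : block k * vec => u k p.1 p.2)} ;
  B_gam_gt0 : forall k, 0 < gam k ;
  B_strong : forall k (v w : block k) (x : vec),
    X k v -> X k w -> prod_set X x ->
    u k w x + edot (grad (u k ^~ x) w) (v - w)
      + gam k / 2 * enorm (v - w) ^+ 2 <= u k v x ;
  B_L_gt0 : forall k, 0 < L k ;
  B_lip : forall k (v w : block k) (x : vec),
    X k v -> X k w -> prod_set X x ->
    enorm (grad (u k ^~ x) v - grad (u k ^~ x) w) <= L k * enorm (v - w) ;
  B_lip_param : forall k (v : block k) (x y : vec),
    X k v -> prod_set X x -> prod_set X y ->
    enorm (grad (u k ^~ x) v - grad (u k ^~ y) v) <= G k * enorm (x - y)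
}.

(* With values in \bar R, the bound at x = y forces [sep_sum h] to be finite
   on the feasible set. *)
Definition sep_sum_lipschitz (X : forall k, set (block k))
    (h : forall k, block k -> \bar R) (Lh : R) :=
  forall x y, prod_set X x -> prod_set X y ->
    (`|sep_sum h x - sep_sum h y| <= (Lh * enorm (x - y))%:E)%E.

Definition level_set (X : forall k, set (block k)) (f : vec -> \bar R)
    (x1 : vec) : set vec :=
  [set x | prod_set X x /\ (f x <= f x1)%E].

(* Suprema stand for maxima: the level set is nonempty and assumed compact. *)
Definition level_radius (X : forall k, set (block k)) (f : vec -> \bar R)
    (x1 : vec) : R :=
  sup [set t | exists x xs, [/\ level_set X f x1 x, optimal_set X f xs
                               & t = enorm (x - xs)]].

Definition level_grad_bound (X : forall k, set (block k)) (g : vec -> R)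
    (f : vec -> \bar R) (x1 : vec) : R :=
  sup [set enorm (grad g x) | x in level_set X f x1].

(* min over v in X_k of f(v, x_{-k}) *)
Definition block_min (X : forall k, set (block k)) (f : vec -> \bar R)
    (x : vec) (k : 'I_K) : \bar R :=
  ereal_inf [set f (set_block x k v) | v in X k].

(* One iteration of block coordinate minimization with the maximum block
   improvement rule; ties and non-unique minimizers are resolved
   arbitrarily. *)
Definition mbi_step (X : forall k, set (block k)) (g : vec -> R)
    (h : forall k, block k -> \bar R) (x x' : vec) : Prop :=
  exists k : 'I_K,
    [/\ forall j, (block_min X (objective g h) x k
                     <= block_min X (objective g h) x j)%E,
        argmin_on (X k) (fun v => ((g (set_block x k v))%:E + h k v)%E)
          (submxrow x' k)
      & forall j, j != k -> submxrow x' j = submxrow x j].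

(* The iterates are x 1, x 2, ...; the value x 0 is irrelevant. *)
Definition mbi_sequence (X : forall k, set (block k)) (g : vec -> R)
    (h : forall k, block k -> \bar R) (x : nat -> vec) : Prop :=
  prod_set X (x 1%N) /\ forall r, (1 <= r)%N -> mbi_step X g h (x r) (x r.+1).

End Blocks.
Arguments set_block {R K n} x k v.

(* inf and sup over the K >= 1 blocks are a minimum and a maximum. *)
Definition gamma_min (R : realType) (K : nat) (gam : 'I_K -> R) : R :=
  2^-1 * inf (range gam).

Definition L_max (R : realType) (K : nat) (L : 'I_K -> R) : R := sup (range L).

Definition sigma3 (R : realType) (K : nat) (gamma Lmax Q Lh rad : R) : R :=
  gamma / (2 * K%:R * ((Q + Lh) ^+ 2 + Lmax ^+ 2 * K%:R * rad ^+ 2)).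

(* Main.v *)
Require Import Defs.
From HB Require Import structures.
From mathcomp Require Import all_boot all_order all_algebra.
From mathcomp Require Import all_classical all_reals all_analysis.
From mathcomp Require Import lra ring.

Set Implicit Arguments.
Unset Strict Implicit.
Unset Printing Implicit Defensive.

Import Order.TTheory GRing.Theory Num.Theory.
Import numFieldNormedType.Exports.

Local Open Scope classical_set_scope.
Local Open Scope ring_scope.

(** Fix an iterate [x] and let [y] be the point whose block [y_k] minimizes
    [u_k(.; x) + h_k] over [X_k], for all k at once.  The algorithm never
    needs [y], but [a = |x - y|] measures both how far [x] is from optimal and
    how much the next step gains.

    Gain ([prox_point_descent], [mbi_step_le]).  Strong convexity of [u_k]
    and optimality of [y_k] show that moving block k alone from [x_k] to
    [y_k] decreases [f] by at least [gamma_k / 2 * |x_k - y_k|^2].  The rule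
    of maximum block improvement does at least as well as every such move,
    hence as well as their average: the next iterate [x'] satisfies
    [gamma * a^2 <= K * (f(x) - f(x'))].

    Gap ([optimality_gap], [prox_point_radius]).  Linearize [g] at [x] and
    insert [y] between [x] and a solution [x*].  The part from [x] to [y]
    costs at most [(Q + L_h) * a].  On the part from [y] to [x*], the
    first-order conditions satisfied by the [y_k] leave only
    [<grad u_k(x_k; x) - grad u_k(y_k; x), y_k - x*_k>], which is at most
    [L_k * |x_k - y_k| * R]; here [|y_k - x*_k| <= R] because the point
    [x_{-k}, y_k] is in the level set.  Summing over k with Cauchy-Schwarz,
    [f(x) - f* <= (Q + L_h + L_max * sqrt K * R) * a].

    Eliminating [a] gives [sigma3 * D_r^2 <= D_r - D_(r+1)] for the errors
    [D_r = f(x^r) - f*] ([mbi_sufficient_decrease]), and such a recurrence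
    forces [D_r <= 1 / (sigma3 * r)] ([quadratic_decrease_rate]); it bounds
    even [D_1], since [D_2 >= 0].

    The sets [X_k] may fail to be closed.  The minimizers [y_k] exist because
    the model majorizes [f] and agrees with it at [x], so that its relevant
    sublevel set lies in the compact level set of [f]
    ([model_min_exists]). *)

(** * Euclidean norm and directional derivatives *)

Section Euclidean.
Context {R : realType} {d : nat}.
Implicit Types (u v w : 'rV[R]_d) (a : R).

Lemma edotC u v : edot u v = edot v u.
Proof. by apply: eq_bigr => i _; rewrite mulrC. Qed.

Lemma edotDr u v w : edot u (v + w) = edot u v + edot u w.
Proof.
by rewrite /edot -big_split; apply: eq_bigr => i _; rewrite mxE mulrDr.
Qed.

Lemma edotNr u v : edot u (- v) = - edot u v.
Proof. by rewrite /edot -sumrN; apply: eq_bigr => i _; rewrite mxE mulrN. Qed.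

Lemma edotZr u a v : edot u (a *: v) = a * edot u v.
Proof.
by rewrite /edot mulr_sumr; apply: eq_bigr => i _; rewrite mxE mulrCA.
Qed.

Lemma edotBr u v w : edot u (v - w) = edot u v - edot u w.
Proof. by rewrite edotDr edotNr. Qed.

Lemma edotBl u v w : edot (u - v) w = edot u w - edot v w.
Proof. by rewrite edotC edotBr !(edotC w). Qed.

Lemma edotZl u a v : edot (a *: u) v = a * edot u v.
Proof. by rewrite edotC edotZr edotC. Qed.

Lemma edot_ge0 u : 0 <= edot u u.
Proof. by apply: sumr_ge0 => i _; rewrite -expr2 sqr_ge0. Qed.

Lemma enorm_ge0 u : 0 <= enorm u. Proof. exact: sqrtr_ge0. Qed.

Lemma sqr_enorm u : enorm u ^+ 2 = edot u u.
Proof. by rewrite sqr_sqrtr ?edot_ge0. Qed.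

Lemma enormN u : enorm (- u) = enorm u.
Proof. by rewrite /enorm edotNr edotC edotNr opprK. Qed.

Lemma enorm0_eq0 u : enorm u = 0 -> u = 0.
Proof.
move=> u0; have : edot u u = 0 by rewrite -sqr_enorm u0 expr0n.
move=> /eqP; rewrite psumr_eq0; last by move=> i _; rewrite -expr2 sqr_ge0.
move=> /allP uu; apply/rowP => i; rewrite mxE; apply/eqP.
by have := uu i (mem_index_enum i); rewrite mulf_eq0 orbb.
Qed.

(** Cauchy-Schwarz, by expanding [0 <= | |v| u - |u| v |^2]. *)
Lemma edot_le u v : edot u v <= enorm u * enorm v.
Proof.
have [/enorm0_eq0 ->|u0] := eqVneq (enorm u) 0.
  by rewrite /edot big1 ?mulr_ge0 ?enorm_ge0// => i _; rewrite mxE mul0r.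
have [/enorm0_eq0 ->|v0] := eqVneq (enorm v) 0.
  by rewrite /edot big1 ?mulr_ge0 ?enorm_ge0// => i _; rewrite mxE mulr0.
have uv0 : 0 < enorm u * enorm v by rewrite mulr_gt0// lt0r ?u0 ?v0 enorm_ge0.
have := edot_ge0 (enorm v *: u - enorm u *: v).
rewrite edotBl !edotBr !edotZl !edotZr -!sqr_enorm (edotC v u) => H.
rewrite -subr_ge0 -(pmulr_rge0 _ uv0); nra.
Qed.

Lemma enormD u v : enorm (u + v) <= enorm u + enorm v.
Proof.
rewrite -(ler_pXn2r (n := 2))// ?nnegrE ?addr_ge0 ?enorm_ge0//.
rewrite sqr_enorm edotDr !(edotC (u + v)) !edotDr -!sqr_enorm (edotC v u).
by have := edot_le u v; nra.
Qed.

Lemma enorm_continuous : continuous (@enorm R d).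
Proof.
have cdot : continuous (fun u : 'rV[R]_d => edot u u).
  apply: (continuous_big add_continuous) => i _ u.
  apply: (@cvgM _ _ _ (nbhs_filter u)).
    exact: (@coord_continuous R 1 d 0 i u).
  exact: (@coord_continuous R 1 d 0 i u).
by move=> u; apply: (continuous_comp (cdot u)); exact: sqrt_continuous.
Qed.

End Euclidean.

Lemma enormB_cvg0 (R : realType) d (y : 'rV[R]_d) :
  enorm (y - z) @[z --> y] --> (0 : R).
Proof.
have cont : continuous (fun z : 'rV[R]_d => enorm (y - z)).
  have csub : continuous (fun z : 'rV[R]_d => y - z).
    by move=> z; apply: differentiable_continuous; apply: differentiableB.
  by move=> z; apply: (continuous_comp (csub z)); exact: enorm_continuous.
have enorm0 : enorm (y - y) = 0.
  by rewrite subrr /enorm /edot big1 ?sqrtr0// => i _; rewrite !mxE mul0r.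
by have := cont y; rewrite /continuous_at enorm0.
Qed.

Section Gradient.
Context {R : realType} {d : nat}.
Implicit Types (f : 'rV[R]_d -> R) (x v : 'rV[R]_d).

Lemma derive_edot_grad f x v : differentiable f x ->
  'D_v f x = edot (grad f x) v.
Proof.
move=> fx; rewrite deriveE// {1}[v]row_sum_delta raddf_sum /=.
by apply: eq_bigr => i _; rewrite linearZ/= mxE deriveE// mulrC.
Qed.

(** One-sided difference quotients suffice, as [f] has a two-sided derivative;
    this is what makes the lemma apply at the boundary of a convex set. *)
Lemma edot_grad_ge f x v c : differentiable f x ->
  (forall t, 0 < t < 1 -> t * c <= f (x + t *: v) - f x) ->
  c <= edot (grad f x) v.
Proof.
move=> fx fc; rewrite -derive_edot_grad//.
have /cvg_dnbhs_at_right : derivable f x v by exact: diff_derivable.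
move=> /cvgr_to_ge; apply; near=> t.
have t0 : 0 < t by near: t; exact: nbhs_right_gt.
have t1 : t < 1 by near: t; exact: nbhs_right_lt.
rewrite /= ler_pdivlMl// [_ + x]addrC; apply: fc; exact/andP.
Unshelve. all: by end_near. Qed.

Lemma edot_grad_le f x v c : differentiable f x ->
  (forall t, 0 < t < 1 -> f (x + t *: v) - f x <= t * c) ->
  edot (grad f x) v <= c.
Proof.
move=> fx fc; rewrite -derive_edot_grad//.
have /cvg_dnbhs_at_right : derivable f x v by exact: diff_derivable.
move=> /cvgr_to_le; apply; near=> t.
have t0 : 0 < t by near: t; exact: nbhs_right_gt.
have t1 : t < 1 by near: t; exact: nbhs_right_lt.
rewrite /= ler_pdivrMl// [_ + x]addrC; apply: fc; exact/andP.
Unshelve. all: by end_near. Qed.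

End Gradient.

(** * Block decomposition *)

Section Blocks.
Context {R : realType} {K : nat} {n : 'I_K -> nat}.
Local Notation vec := 'rV[R]_(\sum_(k < K) n k)%N.

Lemma submxrowZ a (x : vec) k : submxrow (a *: x) k = a *: submxrow x k.
Proof. by apply/rowP => i; rewrite !mxE. Qed.

Lemma submxrow_set_block (x : vec) k v :
  submxrow (set_block x k v) k = v.
Proof. by rewrite mxrowK dfwithin. Qed.

Lemma submxrow_set_block_neq (x : vec) k v j : j != k ->
  submxrow (set_block x k v) j = submxrow x j.
Proof. by move=> jk; rewrite mxrowK dfwithout// eq_sym. Qed.

Lemma set_block_submxrow (x : vec) k : set_block x k (submxrow x k) = x.
Proof.
apply/mxrowP => j; have [->|jk] := eqVneq j k.
  by rewrite submxrow_set_block.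
by rewrite submxrow_set_block_neq.
Qed.

Lemma prod_set_set_block (X : forall k, set 'rV[R]_(n k)) (x : vec) k v :
  prod_set X x -> X k v -> prod_set X (set_block x k v).
Proof.
move=> Xx Xv j; have [->|jk] := eqVneq j k; first by rewrite submxrow_set_block.
by rewrite submxrow_set_block_neq.
Qed.

Lemma submxrow_continuous k : continuous (fun x : vec => submxrow x k).
Proof.
move=> u A /nbhs_ballP[e /= e0 eA].
apply/nbhs_ballP; exists e => //= v [_ uv]; apply: eA; split => // i j.
by apply: (le_lt_trans _ (uv i (tagnat.Rank k j))); rewrite !mxE.
Qed.

Lemma edot_submxrow (x y : vec) :
  edot x y = \sum_k edot (submxrow x k) (submxrow y k).
Proof.
have edotE m (u v : 'rV[R]_m) : edot u v = (u *m v^T) 0 0.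
  by rewrite mxE; apply: eq_bigr => i _; rewrite mxE.
rewrite edotE -{1}(submxrowK x) -{1}(submxrowK y) tr_mxrow mul_mxrow_mxcol.
by rewrite summxE; apply: eq_bigr => k _; rewrite edotE.
Qed.

Lemma sqr_enorm_submxrow (x : vec) :
  enorm x ^+ 2 = \sum_k enorm (submxrow x k) ^+ 2.
Proof.
by rewrite sqr_enorm edot_submxrow; apply: eq_bigr => k _; rewrite sqr_enorm.
Qed.

Lemma enorm_submxrow_le (x : vec) k : enorm (submxrow x k) <= enorm x.
Proof.
rewrite -(ler_pXn2r (n := 2))// ?nnegrE ?enorm_ge0//.
rewrite [leRHS]sqr_enorm_submxrow (bigD1 k)//= lerDl.
by apply: sumr_ge0 => j _; rewrite sqr_ge0.
Qed.

(** Cauchy-Schwarz against the all-ones vector of R^K. *)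
Lemma sum_enorm_submxrow_le (x : vec) :
  (\sum_k enorm (submxrow x k)) ^+ 2 <= K%:R * enorm x ^+ 2.
Proof.
set e := const_mx 1 : 'rV[R]_K; set a := \row_k enorm (submxrow x k).
have -> : \sum_k enorm (submxrow x k) = edot e a.
  by apply: eq_bigr => k _; rewrite !mxE mul1r.
have -> : K%:R = enorm e ^+ 2.
  rewrite sqr_enorm /edot (eq_bigr (fun=> 1)).
    by rewrite sumr_const card_ord.
  by move=> k _; rewrite !mxE mul1r.
have -> : enorm x ^+ 2 = enorm a ^+ 2.
  rewrite sqr_enorm_submxrow [RHS]sqr_enorm.
  by apply: eq_bigr => k _; rewrite !mxE expr2.
rewrite -exprMn ler_pXn2r// ?nnegrE ?mulr_ge0 ?enorm_ge0 ?edot_le//.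
by apply: sumr_ge0 => k _; rewrite !mxE mul1r enorm_ge0.
Qed.

End Blocks.

(** * Convexity along segments *)

Lemma convex_set_segment (R : realType) (E : lmodType R) (A : set E) x y
    (t : R) :
  convex_set A -> A x -> A y -> 0 <= t <= 1 -> A (x + t *: (y - x)).
Proof.
move=> cA Ax Ay /andP[t0 t1].
have := cA y x (Itv01 t0 t1); rewrite !inE => /(_ Ay Ax).
by rewrite /conv/= /unstable.onem scalerBl scale1r scalerBr addrCA.
Qed.

Lemma convex_function_segment (R : realType) (E : lmodType R) (A : set E)
    (f : E -> R) x y (t : R) :
  convex_function A f -> A x -> A y -> 0 <= t <= 1 ->
  f (x + t *: (y - x)) <= f x + t * (f y - f x).
Proof.
move=> cf Ax Ay /andP[t0 t1].
have := cf (Itv01 t0 t1) y x; rewrite !inE => /(_ Ay Ax).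
rewrite /conv/= /unstable.onem scalerBl scale1r scalerBr addrCA.
move=> /le_trans; apply.
rewrite -[conv _ _ _]/(t * f y + (1 - t) * f x); lra.
Qed.

Lemma ext_convex_segment (R : realType) d (h : 'rV[R]_d -> \bar R) x y a b
    (t : R) :
  ext_convex h -> h x = a%:E -> h y = b%:E -> 0 <= t <= 1 ->
  (h (x + t *: (y - x))%R <= (a + t * (b - a))%:E)%E.
Proof.
move=> ch hx hy t01.
have := @convex_set_segment R _ (epi h) (x, a) (y, b) t ch.
by rewrite /epi/= hx hy !lexx => /(_ isT isT t01).
Qed.

Lemma convex_edot_grad_le (R : realType) d (A : set 'rV[R]_d) (f : 'rV[R]_d -> R)
    x y :
  convex_function A f -> A x -> A y -> differentiable f x ->
  edot (grad f x) (y - x) <= f y - f x.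
Proof.
move=> cf Ax Ay dfx; apply: edot_grad_le => // t /andP[t0 t1].
have t01 : 0 <= t <= 1 by rewrite (ltW t0) (ltW t1).
by have := convex_function_segment cf Ax Ay t01; lra.
Qed.

(** * The objective on the feasible set, as a real function *)

Section RealObjective.
Context {R : realType} {K : nat} {n : 'I_K -> nat}.
Local Notation vec := 'rV[R]_(\sum_(k < K) n k)%N.
Context (X : forall k, set 'rV[R]_(n k)) (g : vec -> R).
Context (h : forall k, 'rV[R]_(n k) -> \bar R).
Arguments X : clear implicits.
Arguments h : clear implicits.

(** [fine] sends the infinite values to 0, so that [rterm], [rsum] and [robj]
    describe the problem on the feasible set only, where [h] is finite. *)
Definition rterm k v : R := fine (h k v).
Arguments rterm : clear implicits.
Definition rsum (x : vec) : R := \sum_k rterm k (submxrow x k).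
Definition robj (x : vec) : R := g x + rsum x.

Lemma rsum_set_block (x : vec) k v :
  rsum (set_block x k v) = rsum x + rterm k v - rterm k (submxrow x k).
Proof.
rewrite /rsum (bigD1 k)//= [in RHS](bigD1 k)//= submxrow_set_block.
rewrite (eq_bigr (fun j => rterm j (submxrow x j))); first by ring.
by move=> j jk; rewrite submxrow_set_block_neq.
Qed.

Context (Lh : R) (hLip : sep_sum_lipschitz X h Lh) (X0 : prod_set X !=set0).

(** The Lipschitz bound at a pair of equal points makes the whole sum finite,
    and a finite sum of extended reals has finite terms. *)
Lemma term_fin k v : X k v -> h k v \is a fin_num.
Proof.
move: X0 => [y Xy] Xv; have Xyv := prod_set_set_block Xy Xv.
have : sep_sum h (set_block y k v) \is a fin_num.
  have := hLip Xyv Xyv; rewrite -[_ \is a _]andbb -fin_numB -abse_fin_num.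
  by move=> le; rewrite ge0_fin_numE ?abse_ge0// (le_lt_trans le) ?ltry.
move=> /sum_fin_numP/(_ k); rewrite submxrow_set_block; exact.
Qed.

Lemma termE k v : X k v -> h k v = (rterm k v)%:E.
Proof. by move=> Xv; rewrite fineK ?term_fin. Qed.

Lemma sep_sumE x : prod_set X x -> sep_sum h x = (rsum x)%:E.
Proof.
by move=> Xx; rewrite -sumEFin; apply: eq_bigr => k _; rewrite termE.
Qed.

Lemma objectiveE x : prod_set X x -> objective g h x = (robj x)%:E.
Proof. by move=> Xx; rewrite /objective sep_sumE// EFinD. Qed.

Lemma rsum_lipschitz x y : prod_set X x -> prod_set X y ->
  `|rsum x - rsum y| <= Lh * enorm (x - y).
Proof. by move=> Xx Xy; have := hLip Xx Xy; rewrite !sep_sumE. Qed.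

Lemma rterm_segment k v w (t : R) : convex_set (X k) -> ext_convex (h k) ->
  X k v -> X k w -> 0 <= t <= 1 ->
  rterm k (v + t *: (w - v)) <= rterm k v + t * (rterm k w - rterm k v).
Proof.
move=> cX ch Xv Xw t01.
have := ext_convex_segment ch (termE Xv) (termE Xw) t01.
by rewrite termE//; exact: convex_set_segment.
Qed.

(** [X k] is the slice of [prod_set X] through a feasible point. *)
Lemma block_convex k : convex_set (prod_set X) -> convex_set (X k).
Proof.
move: X0 => [y Xy] cX v w t; rewrite !inE => Xv Xw.
have := cX (set_block y k v) (set_block y k w) t.
rewrite !inE => /(_ (prod_set_set_block Xy Xv) (prod_set_set_block Xy Xw)).
move=> /(_ k); rewrite submxrowD !submxrowZ !submxrow_set_block; exact.
Qed.

End RealObjective.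

Arguments rterm {R K n} h k v.

(** * Minimization over one block *)

Section BlockMinimization.
Context {R : realType} {K : nat} {n : 'I_K -> nat}.
Local Notation vec := 'rV[R]_(\sum_(k < K) n k)%N.
Context (X : forall k, set 'rV[R]_(n k)) (g : vec -> R).
Context (h : forall k, 'rV[R]_(n k) -> \bar R).
Arguments X : clear implicits.
Arguments h : clear implicits.
Context (Lh : R) (hLip : sep_sum_lipschitz X h Lh) (X0 : prod_set X !=set0).
Local Notation f := (objective g h).

Lemma level_setE x1 x : prod_set X x1 ->
  level_set X f x1 x <-> prod_set X x /\ robj g h x <= robj g h x1.
Proof.
move=> Xx1; rewrite /level_set/= (objectiveE _ hLip X0 Xx1).
split=> -[Xx]; first by rewrite (objectiveE _ hLip X0 Xx) lee_fin.
by split=> //; rewrite (objectiveE _ hLip X0 Xx) lee_fin.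
Qed.

Lemma rsum_continuous : {within prod_set X, continuous (rsum h)}.
Proof.
apply/subspace_continuousP => y Xy; apply/cvgrPdist_lt => e e0.
have Lh0 : 0 < `|Lh| + 1 by rewrite ltr_wpDl.
have /cvgrPdist_lt/(_ _ (divr_gt0 e0 Lh0)) :
    enorm (y - z) @[z --> within (prod_set X) (nbhs y)] --> (0 : R).
  by apply: cvg_within_filter; exact: enormB_cvg0.
apply: filterS2 (withinT _ _) => z Xz.
rewrite sub0r normrN ger0_norm ?enorm_ge0// ltr_pdivlMr// => lte.
apply: le_lt_trans (rsum_lipschitz hLip X0 Xy Xz) (le_lt_trans _ lte).
by rewrite mulrC ler_wpM2l ?enorm_ge0// (le_trans (ler_norm _))// lerDl.
Qed.

Lemma closed_same_blocks (x : vec) k :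
  closed [set y : vec | forall j, j != k -> submxrow y j = submxrow x j].
Proof.
rewrite (_ : [set _ | _] = \bigcap_(j in [set j | j != k])
    (fun y : vec => submxrow y j) @^-1` [set submxrow x j]); last first.
  by apply/seteqP; split => y.
apply: closed_bigI => j _; apply: preimage_closed.
  by move=> y _; exact: submxrow_continuous.
exact/accessible_closed_set1/hausdorff_accessible/norm_hausdorff.
Qed.

(** Weierstrass on the points of the level set that agree with [x] outside
    block k.  The points [z] of [X k] that fall outside the level set do not
    compete: by majorization the model at [z] is above [f(x1) >= f(x)], which
    is the value of the model at [submxrow x k]. *)
Lemma model_min_exists x1 x k (phi : 'rV[R]_(n k) -> R) :
  prod_set X x1 -> compact (level_set X f x1) -> level_set X f x1 x ->
  {within X k, continuous phi} ->
  (forall v, X k v -> g (set_block x k v) <= phi v) ->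
  phi (submxrow x k) = g x ->
  exists2 v, X k v & forall z, X k z ->
    phi v + rterm h k v <= phi z + rterm h k z.
Proof.
move=> Xx1 cL lx cphi gphi phix.
have [Xx fx] := (level_setE x Xx1).1 lx.
set C := level_set X f x1 `&`
  [set y : vec | forall j, j != k -> submxrow y j = submxrow x j].
have cC : compact C by apply: compact_closedI => //; exact: closed_same_blocks.
have C0 : C !=set0 by exists x; split.
have CX : C `<=` prod_set X by move=> y [[]].
have cPhi : {within C, continuous
    ((fun y : vec => phi (submxrow y k)) + rsum h : vec -> R)}.
  apply: within_continuousD.
    apply/subspace_continuousP => y Cy.
    have /subspace_continuousP/(_ (submxrow y k) (CX _ Cy k)) cphiy := cphi.
    move=> P /cphiy nP; have := @submxrow_continuous R K n k y _ nP.
    apply: (@filterS _ (nbhs y) (nbhs_filter y)) => z Pz Cz.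
    by apply: Pz; exact: CX.
  exact: continuous_subspaceW CX rsum_continuous.
have [y /set_mem Cy ymin] := compact_EVT_min C0 cC cPhi.
have [_ yx] := Cy.
have Xy := CX _ Cy.
have {}ymin z : C z -> phi (submxrow y k) + rsum h y <=
    phi (submxrow z k) + rsum h z by move=> Cz; apply: ymin; exact/mem_set.
have yE : y = set_block x k (submxrow y k).
  apply/mxrowP => j; have [->|jk] := eqVneq j k.
    by rewrite submxrow_set_block.
  by rewrite submxrow_set_block_neq// yx.
exists (submxrow y k); first exact: Xy.
move=> z Xz.
have [zC|zC] := leP (robj g h (set_block x k z)) (robj g h x1).
  have /ymin : C (set_block x k z).
    split; last by move=> j jk; rewrite submxrow_set_block_neq.
    by apply/level_setE => //; split=> //; exact: prod_set_set_block.
  rewrite {2}yE !rsum_set_block submxrow_set_block; lra.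
have := ymin x (conj lx (fun _ _ => erefl)).
have := gphi _ Xz.
move: zC fx; rewrite /robj {2}yE phix !rsum_set_block; lra.
Qed.

(** The nonsmooth term is only convex, so its increment along the segment from
    [v] to [z] is bounded by a chord while [phi] is differentiated. *)
Lemma model_min_variational k (phi : 'rV[R]_(n k) -> R) v z :
  convex_set (X k) -> ext_convex (h k) ->
  X k v -> X k z -> differentiable phi v ->
  (forall z, X k z -> phi v + rterm h k v <= phi z + rterm h k z) ->
  rterm h k v - rterm h k z <= edot (grad phi v) (z - v).
Proof.
move=> cX ch Xv Xz dphi vmin; apply: edot_grad_ge => // t /andP[t0 t1].
have t01 : 0 <= t <= 1 by rewrite (ltW t0) (ltW t1).
have := rterm_segment hLip X0 cX ch Xv Xz t01.
have := vmin _ (convex_set_segment cX Xv Xz t01); lra.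
Qed.

(** The best block beats every block, and the minimum over a block beats every
    point of that block. *)
Lemma mbi_step_le x x' : prod_set X x -> mbi_step X g h x x' ->
  prod_set X x' /\ forall k v, X k v -> robj g h x' <= robj g h (set_block x k v).
Proof.
move=> Xx [k [kmin [Xk vmin] x'E]].
have x'x : x' = set_block x k (submxrow x' k).
  apply/mxrowP => j; have [->|jk] := eqVneq j k.
    by rewrite submxrow_set_block.
  by rewrite submxrow_set_block_neq// x'E.
have Xx' : prod_set X x' by rewrite x'x; exact: prod_set_set_block.
split=> // j w Xw; rewrite -lee_fin.
rewrite -(objectiveE _ hLip X0 (prod_set_set_block Xx Xw)).
apply: (@le_trans _ _ (block_min X f x j)); last first.
  by apply: ereal_inf_lbound; exists w.
apply: le_trans (kmin j); apply/ereal_infP => _ [v Xv <-].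
rewrite (objectiveE _ hLip X0 (prod_set_set_block Xx Xv)) lee_fin.
have := vmin v Xv; rewrite -x'x !(termE hLip X0)// -!EFinD lee_fin.
by rewrite /robj x'x !rsum_set_block submxrow_set_block -?x'x; lra.
Qed.

End BlockMinimization.

(** * One iteration *)

Section FiniteExtrema.
Context {R : realType} {K : nat} (hK : (0 < K)%N).

Lemma inf_range_le (a : 'I_K -> R) k : inf (range a) <= a k.
Proof.
apply: ge_inf; last by exists k.
have [i _ imin] := arg_minP a (erefl (predT (Ordinal hK))).
by exists (a i) => _ [j _ <-]; exact: imin.
Qed.

Lemma inf_range_gt0 (a : 'I_K -> R) : (forall k, 0 < a k) -> 0 < inf (range a).
Proof.
move=> a0; have [i _ imin] := arg_minP a (erefl (predT (Ordinal hK))).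
apply: lt_le_trans (a0 i) _; apply: lb_le_inf.
  by exists (a (Ordinal hK)), (Ordinal hK).
by move=> _ [j _ <-]; exact: imin.
Qed.

Lemma sup_range_ge (a : 'I_K -> R) k : a k <= sup (range a).
Proof.
apply: ub_le_sup; last by exists k.
have [i _ imax] := arg_maxP a (erefl (predT (Ordinal hK))).
by exists (a i) => _ [j _ <-]; exact: imax.
Qed.

End FiniteExtrema.

Section OneStep.
Context {R : realType} {K : nat} {n : 'I_K -> nat}.
Local Notation vec := 'rV[R]_(\sum_(k < K) n k)%N.
Context (X : forall k, set 'rV[R]_(n k)) (g : vec -> R).
Context (h : forall k, 'rV[R]_(n k) -> \bar R).
Arguments X : clear implicits.
Arguments h : clear implicits.
Context (Mk : 'I_K -> R) (M Lh : R).
Context (u : forall k, 'rV[R]_(n k) -> vec -> R) (gam L G : 'I_K -> R).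
Arguments u : clear implicits.
Context (hA : assumptionA X g h Mk M) (hLip : sep_sum_lipschitz X h Lh).
Context (hB : assumptionB X g u gam L G).
Local Notation f := (objective g h).

Let X0 : prod_set X !=set0.
Proof. by have [xs [Xxs _]] := A_attained hA; exists xs. Qed.

Let blockX k : convex_set (X k) := block_convex X0 (A_set_convex hA).

(** A Jacobi update of the K models: all blocks move at once, whereas an
    iteration of the algorithm moves one. *)
Definition prox_point (x y : vec) := prod_set X y /\ forall k v, X k v ->
  u k (submxrow y k) x + rterm h k (submxrow y k) <= u k v x + rterm h k v.

Lemma prox_point_exists x1 x : prod_set X x1 -> compact (level_set X f x1) ->
  level_set X f x1 x -> exists y, prox_point x y.
Proof.
move=> Xx1 cL lx; have Xx : prod_set X x by case: lx.
have vE k : exists2 v, X k v & forall z, X k z ->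
    u k v x + rterm h k v <= u k z x + rterm h k z.
  apply: (model_min_exists hLip X0 Xx1 cL lx (phi := u k ^~ x)).
  - have cu : {within X k `*` prod_set X,
        continuous (fun p : 'rV[R]_(n k) * vec => u k p.1 p.2)}.
      exact: (B_cont hB).
    apply/subspace_continuousP => v Xv.
    have /subspace_continuousP/(_ (v, x) (conj Xv Xx)) uvx := cu.
    move=> P /uvx [[A B] /= [nA nB] AB].
    apply: (@filterS _ (nbhs v) (nbhs_filter v)) nA => w Aw Xw.
    by apply: (AB (w, x)) => //; split=> //; exact: nbhs_singleton nB.
  - by move=> v Xv; exact: (B_upper hB).
  - exact: (B_tight hB).
exists (\mxrow_k s2val (cid2 (vE k))); split=> k.
  by rewrite mxrowK; case: cid2.
by move=> v Xv; rewrite mxrowK; case: cid2 => /= w _; exact.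
Qed.

Lemma prox_point_variational x y k v : prod_set X x -> prox_point x y ->
  X k v -> rterm h k (submxrow y k) - rterm h k v <=
           edot (grad (u k ^~ x) (submxrow y k)) (v - submxrow y k).
Proof.
move=> Xx [Xy ymin] Xv; apply: (model_min_variational hLip X0) => //.
- exact: (A_h_convex hA).
- exact: (B_diff hB).
- exact: ymin.
Qed.

(** The model decreases by the strong convexity gap at its minimizer, and
    equals [f] at [x] and majorizes it at the new point. *)
Lemma prox_point_descent x y k : prod_set X x -> prox_point x y ->
  gam k / 2 * enorm (submxrow (x - y) k) ^+ 2
    <= robj g h x - robj g h (set_block x k (submxrow y k)).
Proof.
move=> Xx yprox; have [Xy _] := yprox.
have := B_strong hB (Xx k) (Xy k) Xx.
have := prox_point_variational Xx yprox (Xx k).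
have := B_upper hB (Xy k) Xx.
rewrite (B_tight hB k Xx) submxrowB /robj rsum_set_block; lra.
Qed.

(** The inner products [<grad_k g(x), y_k - x*_k>] of the linearization combine
    with the first-order conditions of the [y_k], because [grad_k g(x)] is the
    gradient of the k-th model at [x_k]. *)
Lemma optimality_gap x y xs : prod_set X x -> prod_set X xs -> prox_point x y ->
  robj g h x - robj g h xs <= (enorm (grad g x) + Lh) * enorm (x - y)
    + \sum_k L k * enorm (submxrow (x - y) k) * enorm (submxrow (y - xs) k).
Proof.
move=> Xx Xxs yprox; have [Xy _] := yprox.
have gx := convex_edot_grad_le (A_g_convex hA) Xx Xxs (A_smooth hA Xx).
have rxy := le_trans (ler_norm _) (rsum_lipschitz hLip X0 Xx Xy).
have gxy := edot_le (grad g x) (x - y).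
suff : edot (grad g x) (y - xs) + (rsum h y - rsum h xs) <=
    \sum_k L k * enorm (submxrow (x - y) k) * enorm (submxrow (y - xs) k).
  move: gx gxy; rewrite !edotBr /robj; lra.
rewrite edot_submxrow /rsum -sumrB -big_split /=; apply: ler_sum => k _.
rewrite -/(grad_block g k x) -(B_grad hB k Xx) !submxrowB.
have := prox_point_variational Xx yprox (Xxs k).
have := edot_le (grad (u k ^~ x) (submxrow x k) - grad (u k ^~ x) (submxrow y k))
  (submxrow y k - submxrow xs k).
have := ler_wpM2r (enorm_ge0 (submxrow y k - submxrow xs k))
  (B_lip hB (Xx k) (Xy k) Xx).
rewrite edotBl !edotBr; lra.
Qed.

Context (x1 : vec) (Xx1 : prod_set X x1) (cL : compact (level_set X f x1)).
Local Notation Q := (level_grad_bound X g f x1).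
Local Notation rad := (level_radius X f x1).

Lemma optimal_level xs : optimal_set X f xs -> level_set X f x1 xs.
Proof. by move=> [Xxs xsmin]; split=> //; exact: xsmin. Qed.

Lemma level_enorm_bounded :
  exists B, forall y, level_set X f x1 y -> enorm y <= B.
Proof.
have [|c _ cmax] := compact_EVT_max _ cL
  (continuous_subspaceT (@enorm_continuous R _)).
  by exists x1.
by exists (enorm c) => y ly; apply: cmax; exact/mem_set.
Qed.

Lemma level_radius_ge x xs : level_set X f x1 x -> optimal_set X f xs ->
  enorm (x - xs) <= rad.
Proof.
move=> lx oxs; apply: ub_le_sup; last by exists x, xs.
have [B leB] := level_enorm_bounded.
exists (B + B) => _ [y [ys [ly oys ->]]].
rewrite (le_trans (enormD _ _))// enormN lerD// leB//.
exact: optimal_level.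
Qed.

(** The gradient is Lipschitz on the feasible set, hence bounded on the bounded
    level set. *)
Lemma level_grad_bound_ge x : level_set X f x1 x -> enorm (grad g x) <= Q.
Proof.
move=> lx; apply: ub_le_sup; last by exists x.
have [B leB] := level_enorm_bounded.
have lx1 : level_set X f x1 x1 by [].
exists (M * (B + B) + enorm (grad g x1)) => _ [y ly <-].
rewrite -[grad g y](subrK (grad g x1)) (le_trans (enormD _ _))// lerD2r.
have Xy : prod_set X y by case: ly.
rewrite (le_trans (A_lip hA Xy Xx1))// ler_pM2l ?(A_M_gt0 hA)//.
by rewrite (le_trans (enormD _ _))// enormN lerD// leB.
Qed.

(** The point [y] itself may leave the level set, but [x] with its k-th block
    replaced by that of [y] does not, and it has the same k-th block. *)
Lemma prox_point_radius x y xs k : level_set X f x1 x -> prox_point x y ->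
  optimal_set X f xs -> enorm (submxrow (y - xs) k) <= rad.
Proof.
move=> lx yprox oxs; have [Xx fx] := (level_setE g hLip X0 x Xx1).1 lx.
have [Xy _] := yprox.
set z := set_block x k (submxrow y k).
have lz : level_set X f x1 z.
  apply/(level_setE g hLip X0 _ Xx1); split; first exact: prod_set_set_block.
  have := prox_point_descent k Xx yprox.
  have : 0 <= gam k / 2 * enorm (submxrow (x - y) k) ^+ 2.
    by rewrite mulr_ge0 ?sqr_ge0// divr_ge0 ?ltW ?(B_gam_gt0 hB).
  rewrite -/z; lra.
apply: le_trans (level_radius_ge lz oxs).
have -> : submxrow (y - xs) k = submxrow (z - xs) k.
  by rewrite !submxrowB submxrow_set_block.
exact: enorm_submxrow_le.
Qed.

Context (hK : (0 < K)%N) (hLh : 0 < Lh).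

Lemma level_grad_bound_ge0 : 0 <= Q.
Proof. exact: le_trans (enorm_ge0 _) (level_grad_bound_ge (x := x1) _). Qed.

Lemma gamma_min_gt0 : 0 < gamma_min gam.
Proof.
by rewrite mulr_gt0 ?invr_gt0 ?inf_range_gt0//; exact: (B_gam_gt0 hB).
Qed.

Lemma sigma3_denom_gt0 :
  0 < (Q + Lh) ^+ 2 + L_max L ^+ 2 * K%:R * rad ^+ 2.
Proof.
rewrite ltr_pwDl ?exprn_gt0 ?ltr_wpDl ?level_grad_bound_ge0//.
by rewrite mulr_ge0 ?sqr_ge0// mulr_ge0 ?sqr_ge0// ler0n.
Qed.

Lemma sigma3_gt0 : 0 < sigma3 K (gamma_min gam) (L_max L) Q Lh rad.
Proof.
by rewrite divr_gt0 ?gamma_min_gt0// !mulr_gt0 ?ltr0n ?sigma3_denom_gt0.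
Qed.

(** Averaging the K possible gains loses the factor K; the factor 2 comes from
    [(p + q)^2 <= 2 (p^2 + q^2)], with [p] and [q] the two parts of the gap. *)
Lemma mbi_sufficient_decrease x x' xs :
  level_set X f x1 x -> mbi_step X g h x x' -> optimal_set X f xs ->
  sigma3 K (gamma_min gam) (L_max L) Q Lh rad * (robj g h x - robj g h xs) ^+ 2
    <= robj g h x - robj g h x'.
Proof.
move=> lx step oxs.
have [Xx fx] := (level_setE g hLip X0 x Xx1).1 lx.
have Xxs : prod_set X xs by case: oxs.
have [y yprox] := prox_point_exists Xx1 cL lx; have [Xy _] := yprox.
have [Xx' x'min] := mbi_step_le hLip X0 Xx step.
set D := robj g h x - robj g h xs; set d := robj g h x - robj g h x'.
set a := enorm (x - y); set s := \sum_k enorm (submxrow (x - y) k).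
have a0 : 0 <= a by exact: enorm_ge0.
have s0 : 0 <= s by apply: sumr_ge0 => k _; exact: enorm_ge0.
have Q0 : 0 <= Q := level_grad_bound_ge0.
have rad0 : 0 <= rad := le_trans (enorm_ge0 _) (level_radius_ge lx oxs).
have Lmax0 : 0 < L_max L.
  exact: lt_le_trans (B_L_gt0 hB (Ordinal hK)) (sup_range_ge hK _ _).
have gam0 := gamma_min_gt0.
have K0 : 0 < K%:R :> R by rewrite ltr0n.
have D0 : 0 <= D.
  have [_ /(_ _ Xx)] := oxs.
  by rewrite !(objectiveE _ hLip X0)// lee_fin subr_ge0.
have decr : gamma_min gam * a ^+ 2 <= K%:R * d.
  rewrite /a sqr_enorm_submxrow mulr_sumr.
  rewrite (_ : K%:R * d = \sum_(k < K) d); last first.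
    by rewrite sumr_const card_ord mulr_natl.
  apply: ler_sum => k _.
  apply: (@le_trans _ _ (gam k / 2 * enorm (submxrow (x - y) k) ^+ 2)).
    rewrite ler_wpM2r ?sqr_ge0// /gamma_min mulrC ler_pM2r ?invr_gt0//.
    exact: inf_range_le.
  apply: le_trans (prox_point_descent k Xx yprox) _.
  by rewrite lerD2l lerN2; exact: x'min.
have gap : D <= (Q + Lh) * a + L_max L * rad * s.
  apply: le_trans (optimality_gap Xx Xxs yprox) _; apply: lerD.
    by rewrite ler_wpM2r// lerD2r level_grad_bound_ge.
  rewrite mulr_sumr; apply: ler_sum => k _; rewrite mulrAC.
  rewrite ler_wpM2r ?enorm_ge0// ler_pM ?enorm_ge0//.
  - exact/ltW/(B_L_gt0 hB).
  - exact: sup_range_ge.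
  - exact: (prox_point_radius _ lx yprox oxs).
have sa : s ^+ 2 <= K%:R * a ^+ 2 := sum_enorm_submxrow_le _.
set C := (Q + Lh) ^+ 2 + L_max L ^+ 2 * K%:R * rad ^+ 2.
have QL0 : 0 < Q + Lh by rewrite ltr_wpDl.
have C0 : 0 < C := sigma3_denom_gt0.
have DC : D ^+ 2 <= 2 * C * a ^+ 2.
  set p := (Q + Lh) * a in gap; set q := L_max L * rad * s in gap.
  have q0 : 0 <= q by rewrite !mulr_ge0// ltW.
  have p0 : 0 <= p by rewrite mulr_ge0// ltW.
  have Dpq : D ^+ 2 <= (p + q) ^+ 2.
    by rewrite ler_pXn2r// nnegrE addr_ge0.
  have q2 : q ^+ 2 <= L_max L ^+ 2 * rad ^+ 2 * (K%:R * a ^+ 2).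
    by rewrite /q !exprMn ler_wpM2l// mulr_ge0 ?sqr_ge0.
  have pq : 0 <= (p - q) ^+ 2 by exact: sqr_ge0.
  have p2 : p ^+ 2 = (Q + Lh) ^+ 2 * a ^+ 2 by rewrite exprMn.
  have -> : 2 * C * a ^+ 2 =
      2 * (p ^+ 2 + L_max L ^+ 2 * rad ^+ 2 * (K%:R * a ^+ 2)).
    by rewrite p2 /C; ring.
  move: Dpq pq; rewrite sqrrD sqrrB; lra.
rewrite /sigma3 -/C mulrAC ler_pdivrMr; last by rewrite !mulr_gt0.
apply: (@le_trans _ _ (gamma_min gam * (2 * C * a ^+ 2))).
  by rewrite ler_pM2l.
have -> : gamma_min gam * (2 * C * a ^+ 2) = 2 * C * (gamma_min gam * a ^+ 2).
  by ring.
have -> : d * (2 * K%:R * C) = 2 * C * (K%:R * d) by ring.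
by rewrite ler_pM2l// mulr_gt0.
Qed.

End OneStep.

(** * Convergence rate *)

(** The induction starts at r = 1 with no assumption on [e 1]: as [e 2 >= 0],
    the recurrence itself gives [s * e 1 ^ 2 <= e 1]. *)
Lemma quadratic_decrease_rate (R : realFieldType) (s : R) (e : nat -> R) :
  0 < s ->
  (forall r, (1 <= r)%N -> 0 <= e r) ->
  (forall r, (1 <= r)%N -> s * e r ^+ 2 <= e r - e r.+1) ->
  forall r, (1 <= r)%N -> e r <= 1 / (s * r%:R).
Proof.
move=> s0 e0 es [//|r] _.
rewrite ler_pdivlMr ?mulr_gt0 ?ltr0n// mulrCA.
elim: r => [|r IH].
  have := es 1%N isT; have := e0 2%N isT; have := e0 1%N isT.
  move: (e 1%N) (e 2%N) => d d' d0 d'0 dd'; rewrite mulr1 leNgt.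
  apply/negP => sd1; have d_gt0 : 0 < d.
    by rewrite -(pmulr_rgt0 _ s0) (lt_trans _ sd1).
  have : 0 < d * (s * d - 1) by rewrite mulr_gt0// subr_gt0.
  lra.
have := es r.+1 isT; have := e0 r.+1 isT; have := e0 r.+2 isT.
rewrite [r.+2%:R]mulrS; move: IH (ltr0Sn R r).
move: (e r.+1) (e r.+2) (r.+1%:R : R) => d d' m IH m0 d'0 d0 dd'.
have sm0 : 0 < s * (1 + m) by rewrite mulr_gt0 ?addr_gt0.
have [le1|gt1] := leP (s * (1 + m) * d) 1.
  have sd2 : 0 <= s * d ^+ 2 by rewrite mulr_ge0 ?sqr_ge0 1?ltW.
  apply: le_trans le1; rewrite [d' * _]mulrC mulrA ler_pM2l//; lra.
(* with t = s d, (1 + m) t (1 - t) = m t - t ((1 + m) t - 1) <= m t *)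
have : s * (1 + m) * d' <= s * (1 + m) * (d - s * d ^+ 2).
  by rewrite ler_pM2l//; lra.
have : 0 <= s * d * (s * (1 + m) * d - 1).
  by rewrite mulr_ge0 ?subr_ge0 ?(ltW gt1)// mulr_ge0// ltW.
move: IH; lra.
Qed.

Theorem mainTheorem5 (R : realType) (K : nat) (hK : (0 < K)%N)
  (n : 'I_K -> nat)
  (X : forall k, set 'rV[R]_(n k))
  (g : 'rV[R]_(\sum_(k < K) n k)%N -> R)
  (h : forall k, 'rV[R]_(n k) -> \bar R)
  (Mk : 'I_K -> R) (M Lh : R)
  (u : forall k, 'rV[R]_(n k) -> 'rV[R]_(\sum_(k < K) n k)%N -> R)
  (gam L G : 'I_K -> R)
  (x : nat -> 'rV[R]_(\sum_(k < K) n k)%N)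
  (f := objective g h)
  (hA : assumptionA X g h Mk M)
  (hLh : 0 < Lh)
  (hLip : sep_sum_lipschitz X h Lh)
  (hB : assumptionB X g u gam L G)
  (hseq : mbi_sequence X g h x)
  (hcompact : compact (level_set X f (x 1%N)))
  (Q := level_grad_bound X g f (x 1%N))
  (rad := level_radius X f (x 1%N))
  (sigma := sigma3 K (gamma_min gam) (L_max L) Q Lh rad) :
  forall r : nat, (1 <= r)%N ->
    (f (x r) - optimal_value X f <= (1 / (sigma * r%:R))%:E)%E.
Proof.
have [Xx1 step] := hseq.
have [xs oxs] := A_attained hA; have [Xxs xsmin] := oxs.
have X0 : prod_set X !=set0 by exists xs.
have lx r : (1 <= r)%N -> level_set X f (x 1%N) (x r).
  case: r => // r _; elim: r => [|r IH]; first by [].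
  have [Xr fr] := (level_setE g hLip X0 _ Xx1).1 IH.
  have [Xr' fr'] := mbi_step_le hLip X0 Xr (step r.+1 isT).
  apply/(level_setE g hLip X0 _ Xx1); split=> //; apply: le_trans fr.
  by have := fr' (Ordinal hK) _ (Xr _); rewrite set_block_submxrow.
have Xx r (r1 : (1 <= r)%N) : prod_set X (x r) by case: (lx r r1).
have fE y : prod_set X y -> f y = (robj g h y)%:E.
  by move=> Xy; rewrite /f (objectiveE g hLip X0).
have optE : optimal_value X f = (robj g h xs)%:E.
  rewrite -fE//; apply/eqP; rewrite eq_le; apply/andP; split.
    by apply: ereal_inf_lbound; exists xs.
  by apply/ereal_infP => _ [y Xy <-]; exact: xsmin.
have sigma_gt0 : 0 < sigma.
  exact: (sigma3_gt0 hA hB Xx1 hcompact hK hLh).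
move=> r r1; rewrite optE (fE _ (Xx r r1)) -EFinB lee_fin.
apply: (quadratic_decrease_rate (e := fun r => robj g h (x r) - robj g h xs)
  sigma_gt0) => // {r1}r r1.
  by rewrite subr_ge0 -lee_fin -!fE//; [exact: xsmin (Xx r r1)|exact: Xx].
have := mbi_sufficient_decrease hA hLip hB Xx1 hcompact hK hLh (lx r r1)
  (step r r1) oxs.
by rewrite opprB addrA subrK.
Qed.
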